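(* Let $0<\tau<\infty$ and $\log\Big(2\big\lceil 2^{\frac{1+\tau}{\tau}}\big\rceil^{\frac{1}{1+\tau}}\Big)<h<\infty$. Then there exists a topological dynamical system $(X,f)$ satisfying the non-uniform $\tau$-specification property with gap function $M(n,\varepsilon)$ such that: (1) for all sufficiently small $\varepsilon>0$, $\lim_{n\to\infty}\frac{M(n,\varepsilon)}{n}=\tau$; (2) $h_{top}(f)=h$.
   Context: A topological dynamical system $(X,f)$ consists of a compact metric space $(X,d)$ with at least two points and a continuous map $f:X\to X$. $h_{top}(f)$ is topological entropy. Non-uniform specification: $(X,f)$ has the non-uniform specification property with gap function $M:\mathbb{N}\times(0,\infty)\to\mathbb{N}$ ($\mathbb{N}$ the positive integers) if $M(n,\varepsilon)$ is non-decreasing in $n$ and non-increasing in $\varepsilon$, and for every $\varepsilon>0$, every integer $k\ge2$, all $x_1,\dots,x_k\in X$ and all non-negative integers $a_1\le b_1<a_2\le b_2<\cdots<a_k\le b_k$ with $a_{i+1}-b_i\ge M(b_i-a_i+1,\varepsilon)$ for $1\le i\le k-1$, there is $z\in X$ with $d(f^{n-a_i}x_i,f^nz)\le\varepsilon$ for all $a_i\le n\le b_i$, $1\le i\le k$. Let $\mathscr{G}(X,f)$ be the set of all such gap functions for $(X,f)$ and $\tau(M)=\sup_{\varepsilon>0}\liminf_{n\to\infty}M(n,\varepsilon)/n\in[0,\infty]$. $(X,f)$ has the non-uniform $\tau$-specification property if there is $M\in\mathscr{G}(X,f)$ with $\tau(M)=\tau$ and every $M'\in\mathscr{G}(X,f)$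 satisfies $\tau(M')\ge\tau$; ''with gap function $M$'' means $M\in\mathscr{G}(X,f)$. *)

(* Defs.v *)
From HB Require Import structures.
From mathcomp Require Import all_boot all_order all_algebra finmap.
From mathcomp Require Import all_classical all_reals all_analysis.

Set Implicit Arguments.
Unset Strict Implicit.
Unset Printing Implicit Defensive.

Import Order.TTheory GRing.Theory Num.Theory.
Import numFieldNormedType.Exports.

Local Open Scope classical_set_scope.
Local Open Scope ring_scope.

Definition topological_dynamical_system (R : realType) (X : metricType R)
    (f : X -> X) : Prop :=
  [/\ compact [set: X], exists x y : X, x <> y & continuous f].

Definition bowen_dist (R : realType) (X : metricType R) (f : X -> X)
    (n : nat) (x y : X) : R :=
  \big[Num.max/0]_(i < n) mdist (iter i f x) (iter i f y).

Definition bowen_separated (R : realType) (X : metricType R) (f : X -> X)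
    (n : nat) (e : R) (A : {fset X}) : Prop :=
  forall x y, x \in A -> y \in A -> x != y -> e < bowen_dist f n x y.

(* A supremum in \bar R; for compact X, continuous f and e > 0 it is a finite
   maximum. *)
Definition max_separated (R : realType) (X : metricType R) (f : X -> X)
    (n : nat) (e : R) : \bar R :=
  ereal_sup [set (#|` A|%fset%:R)%:E | A in [set A | bowen_separated f n e A]].

(* Bowen's definition, with the natural logarithm.  The limsup is
   nonincreasing in e, so the limit as e tends to 0 from the right exists
   in \bar R. *)
Definition topological_entropy (R : realType) (X : metricType R)
    (f : X -> X) : \bar R :=
  lim (limn_esup (fun n => (n%:R^-1)%:E * lne (max_separated f n e))%E
         @[e --> 0^'+]).

(* A gap function lives on {1, 2, ...} x ]0, +oo[ with values in {1, 2, ...};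
   it is encoded as a function on nat x R, and nothing is required of its
   values outside that domain.  The k orbit segments are indexed from 0, and
   only the entries i < k of x, a and b are used. *)
Definition gap_function (R : realType) (X : metricType R) (f : X -> X)
    (M : nat -> R -> nat) : Prop :=
  [/\ forall n (e : R), (0 < n)%N -> 0 < e -> (0 < M n e)%N,
      forall m n (e : R), (0 < m)%N -> (m <= n)%N -> 0 < e -> (M m e <= M n e)%N,
      forall n (d e : R), (0 < n)%N -> 0 < d -> d <= e -> (M n e <= M n d)%N
    & forall (e : R) (k : nat) (x : nat -> X) (a b : nat -> nat),
        0 < e -> (2 <= k)%N ->
        (forall i, (i < k)%N -> (a i <= b i)%N) ->
        (forall i, (i.+1 < k)%N -> (b i < a i.+1)%N) ->
        (forall i, (i.+1 < k)%N ->
           (M (b i - a i + 1) e <= a i.+1 - b i)%N) ->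
        exists z : X, forall i n, (i < k)%N -> (a i <= n <= b i)%N ->
          mdist (iter (n - a i) f (x i)) (iter n f z) <= e].

Definition gap_rate (R : realType) (M : nat -> R -> nat) : \bar R :=
  ereal_sup [set limn_einf (fun n => ((M n e)%:R / n%:R)%:E)
            | e in [set e : R | 0 < e]].

Definition nonuniform_tau_specification (R : realType) (X : metricType R)
    (f : X -> X) (tau : \bar R) : Prop :=
  (exists2 M, gap_function f M & gap_rate M = tau) /\
  (forall M, gap_function f M -> (tau <= gap_rate M)%E).

(* Main.v *)
Require Import Defs.
From HB Require Import structures.
From mathcomp Require Import all_boot all_order all_algebra finmap.
From mathcomp Require Import all_classical all_reals all_analysis.
From mathcomp Require Import zify lra.

(**
The space consists of the arrays x : nat -> nat -> bool, acted on by the shift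
of the second index, such that
- in row 0, a run of n ones, once ended, is followed by at least tau n zeros;
- in row i + 1, two ones are at distance at least L_i + 1.
Orbit segments are glued by filling the gaps with zeros. In finitely many rows
this takes gaps of length tau n + O(1), whereas joining the word 1^n to the
word 01 in row 0 takes a gap of length at least tau n; hence the rate tau is
attained and optimal.

At scale 1 / (k + 1), the entropy is the growth rate H_k of the number of words
in the rows i < k. Row 0 contributes at most ln 2 < h; row i + 1 contributes
at least ln 2 / (L_i + 1) and at most ln (L_i + 2) / (L_i + 1). Always taking
the least L_i which keeps the total below h makes H_k converge to h: if H_k
stayed below h - e, the L_i would be bounded, and so the positive contributions
of the rows would be bounded from below.
*)

Set Implicit Arguments.
Unset Strict Implicit.
Unset Printing Implicit Defensive.

Import Order.TTheory GRing.Theory Num.Theory.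
Import numFieldNormedType.Exports.

Local Open Scope classical_set_scope.
Local Open Scope ring_scope.

(** * Shift spaces of boolean arrays *)

Definition agree (k : nat) (x y : nat -> nat -> bool) : bool :=
  [forall i : 'I_k, forall t : 'I_k, x i t == y i t].

Lemma agreeP k x y :
  reflect (forall i t, (i < k)%N -> (t < k)%N -> x i t = y i t) (agree k x y).
Proof.
apply: (iffP forallP) => [xy i t ik tk|xy i].
  by have /forallP/(_ (Ordinal tk))/eqP := xy (Ordinal ik).
by apply/forallP => t; rewrite xy.
Qed.

Lemma agreexx k x : agree k x x.
Proof. exact/agreeP. Qed.

Lemma agreeC k x y : agree k x y = agree k y x.
Proof. by apply/agreeP/agreeP => xy i t ik tk; rewrite xy. Qed.

Lemma agree_trans k x y z : agree k x y -> agree k y z -> agree k x z.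
Proof.
by move=> /agreeP xy /agreeP yz; apply/agreeP => i t ik tk; rewrite xy// yz.
Qed.

Lemma agree_le k l x y : (k <= l)%N -> agree l x y -> agree k x y.
Proof.
move=> kl /agreeP xy; apply/agreeP => i t ik tk.
by rewrite xy// (leq_trans _ kl).
Qed.

Lemma agree_eq x y : (forall k, agree k x y) -> x = y.
Proof.
move=> xy; apply/funext => i; apply/funext => t.
have /agreeP -> // := xy (maxn i t).+1; by rewrite ltnS ?leq_maxl ?leq_maxr.
Qed.

Section sequence_distance.
Variable R : realType.

(* [x] and [y] are at distance [1 / k] where [k] is the size of the smallest
   square [0, k) x [0, k) on which they differ. *)
Definition seq_dist (x y : nat -> nat -> bool) : R :=
  if pselect (exists k, ~~ agree k x y) is left e then (ex_minn e)%:R^-1 else 0.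

(** If [m] is the size of the smallest square of disagreement, then [1 / m <= 1 / (k + 1)] means
    [k < m]. All metric estimates below are turned into agreement on squares in this way. *)
Lemma seq_distP x y k : (seq_dist x y <= k.+1%:R^-1) = agree k x y.
Proof.
rewrite /seq_dist; case: pselect => [e|ne]; last first.
  by rewrite invr_ge0 ler0n; apply/esym/negPn/negP => kxy; apply: ne; exists k.
case: ex_minnP => m mxy m_min.
have m0 : (0 < m)%N.
  by rewrite lt0n; apply: contra mxy => /eqP ->; apply/agreeP.
rewrite lef_pV2 ?posrE ?ltr0n// ler_nat.
apply/idP/idP => [km|kxy]; last first.
  by rewrite ltnNge; apply: contra mxy => mk; exact: agree_le kxy.
by apply: contraLR km; rewrite -leqNgt; exact: m_min.
Qed.

Lemma seq_dist_ge0 x y : 0 <= seq_dist x y.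
Proof. by rewrite /seq_dist; case: pselect => // e; rewrite invr_ge0. Qed.

Lemma seq_dist_le x y z w :
  (forall k, agree k z w -> agree k x y) -> seq_dist x y <= seq_dist z w.
Proof.
move=> zwxy; rewrite {2}/seq_dist; case: pselect => [e|ne]; last first.
  rewrite /seq_dist; case: pselect => // e; exfalso; case: e => k kxy.
  by apply: ne; exists k; apply: contra kxy; exact: zwxy.
case: ex_minnP => m mzw m_min.
have m0 : (0 < m)%N.
  by rewrite lt0n; apply: contra mzw => /eqP ->; apply/agreeP.
rewrite -(prednK m0) seq_distP; apply: zwxy; apply: contraT => /m_min.
by rewrite leqNgt ltn_predL m0.
Qed.

Lemma seq_distxx x : seq_dist x x = 0.
Proof.
rewrite /seq_dist; case: pselect => // e; exfalso; case: e => k.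
by rewrite agreexx.
Qed.

Lemma seq_dist_eq0 x y : seq_dist x y = 0 -> x = y.
Proof. by move=> xy0; apply: agree_eq => k; rewrite -seq_distP xy0. Qed.

Lemma seq_distC x y : seq_dist x y = seq_dist y x.
Proof.
by apply/eqP; rewrite eq_le !seq_dist_le// => k; rewrite agreeC.
Qed.

Lemma seq_dist_triangle y x z :
  seq_dist x z <= seq_dist x y + seq_dist y z.
Proof.
have [xy|yx] := leP (seq_dist x y) (seq_dist y z).
- apply: (@le_trans _ _ (seq_dist y z)); last by rewrite lerDr seq_dist_ge0.
  (* Agreement is transitive, so the larger of the two distances already bounds the left-hand side:
     the metric is an ultrametric. *)
  apply: seq_dist_le => k kyz; refine (agree_trans _ kyz).
  by rewrite -seq_distP (le_trans xy)// seq_distP.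
- apply: (@le_trans _ _ (seq_dist x y)); last by rewrite lerDl seq_dist_ge0.
  apply: seq_dist_le => k kxy; apply: (agree_trans kxy).
  by rewrite -seq_distP (le_trans (ltW yx))// seq_distP.
Qed.

End sequence_distance.

(** [R] is a parameter of the type so that the metric with values in [R] can be inferred from it. *)
Record seq_space (R : realType) (P : (nat -> nat -> bool) -> Prop) := SeqSpace {
  coords :> nat -> nat -> bool ;
  coordsP : P coords }.

Section sequence_space.
Variables (R : realType) (P : (nat -> nat -> bool) -> Prop).
Local Notation X := (seq_space R P).

Lemma coords_inj : injective (@coords R P).
Proof.
move=> [x Px] [y Py] /= xy; move: Px Py; rewrite xy => Px Py.
by rewrite (Prop_irrelevance Px Py).
Qed.

HB.instance Definition _ := gen_eqMixin X.
HB.instance Definition _ := gen_choiceMixin X.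

Let dist (x y : X) : R := seq_dist R x y.

Let dist0 x y : dist x y = 0 -> x = y.
Proof. by move=> /seq_dist_eq0/coords_inj. Qed.

HB.instance Definition _ := isMetric.Build R X
  (fun x => seq_distxx R x) dist0 (fun x y => seq_distC R x y)
  (fun x y z => seq_dist_triangle R x y z).

Lemma mdist_seqE (x y : X) : mdist x y = seq_dist R x y.
Proof. by []. Qed.

Lemma mdist_le_agree (x y : X) k : (mdist x y <= k.+1%:R^-1) = agree k x y.
Proof. by rewrite mdist_seqE seq_distP. Qed.

Lemma nbhs_agree (x : X) k : nbhs x [set y : X | agree k x y].
Proof.
have k0 : 0 < k.+1%:R^-1 :> R by rewrite invr_gt0.
apply: filterS (nbhsx_ballx x _ k0) => y.
by rewrite ballEmdist/= => /ltW; rewrite mdist_le_agree.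
Qed.

Lemma agree_nbhs (x : X) (A : set X) : nbhs x A ->
  exists k, forall y : X, agree k x y -> A y.
Proof.
rewrite -filter_from_ballE => -[e /= e0 eA].
exists (Num.truncn e^-1).+1 => y kxy; apply: eA.
rewrite ballEmdist/=; move: kxy; rewrite -mdist_le_agree => /le_lt_trans; apply.
rewrite invf_plt ?posrE//.
by rewrite (lt_trans (truncnS_gt _))// ltr_nat.
Qed.

(** An ultrafilter decides the value of each coordinate. The array [p] of these values is its limit,
    and lies in the space because [P] is closed. *)
Lemma compact_seq_space :
  (forall x, (forall k, exists2 y, P y & agree k x y) -> P x) ->
  compact [set: X].
Proof.
move=> Pclosed; rewrite compact_ultra => F FU _.
pose B i t := [set x : X | coords x i t].
pose p i t : bool := `[< F (B i t) >].
have Fp i t : F [set x : X | coords x i t = p i t].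
  rewrite /p; case: asboolP => Fit.
    by apply: filterS Fit => x.
  have [//|] := in_ultra_setVsetC (B i t) FU.
  by apply: filterS => x /= /negP/negbTE.
have Fk k : F [set x : X | agree k p x].
  have Fpk : \forall x \near F, forall it : 'I_k * 'I_k,
      coords x it.1 it.2 = p it.1 it.2.
    by apply: filter_forall => it; exact: Fp.
  apply: filterS Fpk => x xp; apply/agreeP => i t ik tk.
  by have /= -> := xp (Ordinal ik, Ordinal tk).
have Pp : P p.
  apply: Pclosed => k; have [x kpx] := filter_ex (Fk k).
  by exists x => //; exact: coordsP.
exists (SeqSpace R Pp); split=> // A /agree_nbhs[k kA].
by apply: filterS (Fk k) => x; exact: kA.
Qed.

Definition time_shift (x : nat -> nat -> bool) : nat -> nat -> bool :=
  fun i t => x i t.+1.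

Hypothesis P_shift : forall x, P x -> P (time_shift x).

Definition shift_map (x : X) : X := SeqSpace R (P_shift (coordsP x)).

Lemma iter_shiftE n (x : X) i t : iter n shift_map x i t = x i (n + t)%N.
Proof. by elim: n t => // n IHn t; rewrite iterS/= /time_shift IHn addnS. Qed.

Lemma continuous_shift_map : continuous shift_map.
Proof.
move=> x A /agree_nbhs[k kA].
apply: filterS (nbhs_agree x k.+1) => y /agreeP xy; apply: kA.
apply/agreeP => i t ik tk /=; rewrite /time_shift xy//.
by rewrite ltnS ltnW.
Qed.

End sequence_space.

(** * Growth rates *)

Section growth_rate.
Context {R : realType}.

Lemma le_limn_esup (u v : nat -> \bar R) (c D : R) :
  (forall n, (0 < n)%N -> (u n <= v n + (c + D / n%:R)%:E)%E) ->
  (limn_esup u <= limn_esup v + c%:E)%E.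
Proof.
move=> uv; apply/lee_addgt0Pr => e e0.
rewrite -addeA -EFinD -leeBlDr// {2}/limn_esup limf_esupE.
apply: le_ereal_inf_tmp => _ [V [n0 _ n0V] <-].
rewrite leeBlDr// /limn_esup limf_esupE.
(* From index [m] on, the set [V] is entered and [D / n <= e]. *)
pose m := (maxn n0 (Num.truncn (D / e)).+1).
apply: (@le_trans _ _ (ereal_sup (u @` [set n | (m <= n)%N]))).
  by apply: ereal_inf_lbound; exists [set n | (m <= n)%N] => //; exists m.
apply: ge_ereal_sup => _ [n /= mn <-].
move: mn; rewrite geq_max => /andP[n0n Dn].
have n_gt0 : (0 < n)%N by exact: leq_trans Dn.
apply: (le_trans (uv n n_gt0)); apply: leeD.
  by apply: ereal_sup_ubound; exists n => //; exact: n0V.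
rewrite lee_fin lerD2l ler_pdivrMr ?ltr0n// mulrC -ler_pdivrMr//.
by rewrite (le_trans (ltW (truncnS_gt _)))// ler_nat.
Qed.

Definition growth_rate (u : nat -> R) : \bar R :=
  limn_esup (fun n => (u n / n%:R)%:E).

Lemma le_growth_rate (u v : nat -> R) (c D : R) :
  (forall n, u n <= v n + c * n%:R + D) ->
  (growth_rate u <= growth_rate v + c%:E)%E.
Proof.
move=> uv; apply: (@le_limn_esup _ _ c D) => n n0.
rewrite -EFinD lee_fin ler_pdivrMr ?ltr0n// !mulrDl !mulfVK ?pnatr_eq0 -?lt0n//.
by rewrite addrA.
Qed.

End growth_rate.

(** * Entropy of a product of shift spaces *)

(** Only initial words are recorded; for a shift-invariant [Q] these are all the words that occur in
    its points. *)
Definition words (Q : (nat -> bool) -> Prop) n : {set {ffun 'I_n -> bool}} :=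
  [set w : {ffun 'I_n -> bool} |
     `[< exists2 x, Q x & forall t : 'I_n, w t = x t >]]%SET.

Lemma card_words_gt0 (Q : (nat -> bool) -> Prop) x n : Q x ->
  (0 < #|words Q n|)%N.
Proof.
move=> Qx; apply/card_gt0P; exists [ffun t : 'I_n => x t].
by rewrite inE; apply/asboolP; exists x => // t; rewrite ffunE.
Qed.

Lemma card_wordsS (Q : (nat -> bool) -> Prop) n :
  (#|words Q n.+1| <= #|words Q n| * 2)%N.
Proof.
pose f (w : {ffun 'I_n.+1 -> bool}) :=
  ([ffun t : 'I_n => w (widen_ord (leqnSn n) t)], w ord_max).
rewrite -card_bool -(cardsT bool) -cardsX -(@card_imset _ _ f); last first.
  move=> w v [/ffunP wv wvn]; apply/ffunP => t.
  have [tn|tn] := ltnP t n.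
    have := wv (Ordinal tn); rewrite !ffunE.
    by congr (w _ = v _); exact/val_inj.
  have -> : t = ord_max by apply/val_inj/eqP; rewrite eqn_leq tn -ltnS ltn_ord.
  exact: wvn.
apply/subset_leq_card/fintype.subsetP => _ /imsetP[w + ->].
rewrite inE => /asboolP[x Qx wx].
rewrite finset.in_setX finset.in_setT andbT inE.
by apply/asboolP; exists x => // t; rewrite ffunE wx.
Qed.

Lemma card_words_addn (Q : (nat -> bool) -> Prop) n m :
  (#|words Q (n + m)| <= #|words Q n| * 2 ^ m)%N.
Proof.
elim: m => [|m IHm]; first by rewrite addn0 muln1.
rewrite addnS (leq_trans (card_wordsS _ _))// expnSr mulnA.
by rewrite leq_mul2r IHm orbT.
Qed.

Section product_subshift.
Variables (R : realType) (S : nat -> (nat -> bool) -> Prop).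
Hypothesis S_false : forall i, S i (fun=> false).

Let P (x : nat -> nat -> bool) := forall i, S i (x i).
Hypothesis P_shift : forall x, P x -> P (time_shift x).
Local Notation X := (seq_space R P).
Local Notation f := (@shift_map R _ P_shift).

(** During [n] steps, a [k] by [k] window slides along the first [k] rows. The bound [t < n + k]
    serves the upper count of separated sets, the window [[j, j + k)] the lower one. *)
Lemma bowen_dist_gt n k (x y : X) :
  k.+1%:R^-1 < bowen_dist f n x y <->
  exists i t, [/\ (i < k)%N, (t < n + k)%N & x i t != y i t] /\
    exists2 j, (j < n)%N & (j <= t < j + k)%N.
Proof.
rewrite /bowen_dist; split=> [/bigmax_gtP[|[j _]]|].
- by rewrite ltNge invr_ge0 ler0n.
- rewrite ltNge mdist_le_agree => /forallPn[i /forallPn[t]].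
  rewrite !iter_shiftE => xyit; exists i, (j + t)%N; split.
    by split=> //; rewrite -addnS leq_add// ltnW.
  by exists j => //; rewrite leq_addr ltn_add2l/=.
- move=> [i [t [[ik tnk xyit] [j jn /andP[jt tjk]]]]].
  apply/bigmax_gtP; right; exists (Ordinal jn) => //=.
  rewrite ltNge mdist_le_agree; apply/negP => /agreeP/(_ i (t - j)%N ik).
  rewrite !iter_shiftE subnKC// => /(_ _)/eqP xy.
  by move/negP: xyit; apply; apply: xy; rewrite ltn_subLR.
Qed.

Let box k n := {ffun 'I_k -> {ffun 'I_n -> bool}}.
Let restr k n (x : X) : box k n := [ffun i : 'I_k => [ffun t : 'I_n => x i t]].
Let boxes k n : {set box k n} :=
  [set w in family (fun i : 'I_k => mem (words (S i) n))]%SET.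

Let card_boxes k n : #|boxes k n| = (\prod_(i < k) #|words (S i) n|)%N.
Proof. by rewrite cardsE card_family foldrE big_image. Qed.

(** Points of a separated set are told apart by their restrictions to the first [k] rows and [n + k]
    columns. *)
Lemma card_separated n e k (A : {fset X}) : k.+1%:R^-1 <= e ->
  bowen_separated f n e A ->
  (#|` A| <= \prod_(i < k) #|words (S i) (n + k)|)%N.
Proof.
move=> ke Asep; rewrite -card_boxes.
have inj : {in A &, injective (@restr k (n + k))}.
  move=> x y xA yA /ffunP xy; apply/eqP; apply: contraT => /(Asep _ _ xA yA).
  move=> /(le_lt_trans ke)/bowen_dist_gt[i [t [[ik tnk /negP xyit] _]]].
  case: xyit; apply/eqP; have := xy (Ordinal ik).
  by rewrite !ffunE => /ffunP/(_ (Ordinal tnk)); rewrite !ffunE.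
rewrite -(size_map (@restr k (n + k)) A).
have /card_uniqP <- : uniq (map (@restr k (n + k)) A).
  by rewrite map_inj_in_uniq ?fset_uniq.
apply/subset_leq_card/fintype.subsetP => _ /mapP[x _ ->].
rewrite inE; apply/familyP => i; rewrite inE; apply/asboolP; exists (x i).
  exact: (coordsP x i).
by move=> t; rewrite !ffunE.
Qed.

(** The rows of a point are chosen independently, so every choice of words in the first [k] rows is
    realized. Width [n] suffices here: a difference in column [t < n] is seen at step [t]. *)
Lemma exists_separated n e k : e <= k.+1%:R^-1 ->
  exists2 A : {fset X}, bowen_separated f n e A &
    #|` A| = (\prod_(i < k) #|words (S i) n|)%N.
Proof.
move=> ek.
have /choice[g gK] (w : box k n) :
    exists x : X, w \in boxes k n -> restr k n x = w.
  have [|_] := boolP (w \in boxes k n); last by exists (SeqSpace R S_false).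
  rewrite inE => /familyP wS.
  (* Rows beyond the first [k] are filled with zeros. *)
  have /choice[x xP] i : exists y, S i y /\
      forall (ik : (i < k)%N) (t : 'I_n), w (Ordinal ik) t = y t.
    have [ik|ki] := pselect (i < k)%N; last by exists (fun=> false); split.
    have := wS (Ordinal ik); rewrite inE => /asboolP[y Sy wy].
    by exists y; split=> // ik' t; rewrite -wy (bool_irrelevance ik ik').
  exists (@SeqSpace R P x (fun i => (xP i).1)) => _.
  apply/ffunP => -[i ik]; apply/ffunP => t; rewrite !ffunE/=.
  by rewrite (xP i).2.
have g_inj : {in boxes k n &, injective g}.
  by move=> w v wS vS wv; rewrite -(gK w)// wv gK.
exists [fset x in [seq g w | w <- enum (boxes k n)]]%fset; last first.
  rewrite card_fseq undup_id ?size_map -?cardE ?card_boxes//.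
  rewrite map_inj_in_uniq ?enum_uniq// => w v.
  by rewrite !mem_enum; exact: g_inj.
move=> x y; rewrite !inE => /mapP[w + ->] /mapP[v + ->].
rewrite !mem_enum => wS vS gwv; apply: (le_lt_trans ek).
apply/bowen_dist_gt; apply: contrapT => nwv; move/eqP: gwv; apply; congr g.
apply/ffunP => i; apply/ffunP => t; apply/eqP/negPn/negP => wvit.
apply: nwv; exists i, t; split; first split=> //; first by rewrite ltn_addr.
  by rewrite -(gK w)// -(gK v)// !ffunE in wvit.
exists t => //.
by rewrite leqnn/= -addn1 leq_add2l (leq_ltn_trans _ (ltn_ord i)).
Qed.

End product_subshift.

Section product_entropy.
Variables (R : realType) (S : nat -> (nat -> bool) -> Prop).
Hypothesis S_false : forall i, S i (fun=> false).

Let P (x : nat -> nat -> bool) := forall i, S i (x i).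
Hypothesis P_shift : forall x, P x -> P (time_shift x).
Local Notation X := (seq_space R P).
Local Notation f := (@shift_map R _ P_shift).

Definition log_words k n : R := \sum_(i < k) ln #|words (S i) n|%:R.

Let prod_gt0 k n : (0 < \prod_(i < k) #|words (S i) n|)%N.
Proof. by apply: prodn_gt0 => i; exact: card_words_gt0 (S_false _). Qed.

Let log_wordsE k n : log_words k n = ln (\prod_(i < k) #|words (S i) n|)%:R.
Proof.
rewrite /log_words; elim: k => [|k IHk]; first by rewrite !big_ord0 ln1.
rewrite !big_ord_recr/= natrM lnM ?IHk// posrE ltr0n ?prod_gt0//.
exact: card_words_gt0 (S_false _).
Qed.

Let max_separated_ge0 n e : (0 <= max_separated f n e)%E.
Proof. by apply: ereal_sup_ubound; exists fset0. Qed.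

Lemma entropy_scale_le e k : k.+1%:R^-1 <= e ->
  (limn_esup (fun n => (n%:R^-1)%:E * lne (max_separated f n e)) <=
   growth_rate (log_words k))%E.
Proof.
move=> ke; rewrite -[leRHS]adde0.
(* The [k] extra columns cost a factor of at most [2 ^ k] in each of the [k] rows, which is bounded
   in [n]. *)
apply: (@le_limn_esup _ _ _ _ ((k * k)%:R * ln 2)) => n n0.
rewrite add0r -EFinD -mulrDl mulrC EFinM lee_pmul2l ?lte_fin ?invr_gt0 ?ltr0n//.
rewrite log_wordsE mulr_natl -lnXn ?posrE// -lnM ?posrE ?ltr0n ?exprn_gt0//.
rewrite -lne_EFin ?mulr_gt0 ?ltr0n ?exprn_gt0//.
rewrite lee_lne ?in_itv/= ?max_separated_ge0 ?leey
  ?lee_fin ?mulr_ge0 ?exprn_ge0//.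
apply: ge_ereal_sup => _ [A Asep <-]; rewrite lee_fin -natrX -natrM ler_nat.
rewrite (leq_trans (card_separated ke Asep))//.
apply: (@leq_trans (\prod_(i < k) (#|words (S i) n| * 2 ^ k))%N).
  by apply: leq_prod => i _; exact: card_words_addn.
by rewrite big_split/= prod_nat_const card_ord expnM.
Qed.

Lemma entropy_scale_ge e k : e <= k.+1%:R^-1 ->
  (growth_rate (log_words k) <=
   limn_esup (fun n => (n%:R^-1)%:E * lne (max_separated f n e)))%E.
Proof.
move=> ek; rewrite -[leRHS]adde0.
apply: (@le_limn_esup _ _ _ _ 0) => n n0.
rewrite mul0r addr0 adde0 mulrC EFinM lee_pmul2l ?lte_fin ?invr_gt0 ?ltr0n//.
rewrite log_wordsE -lne_EFin ?ltr0n ?prod_gt0//.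
rewrite lee_lne ?in_itv/= ?max_separated_ge0 ?leey ?lee_fin ?ler0n//.
have [A Asep <-] := exists_separated S_false P_shift n ek.
by apply: ereal_sup_ubound; exists A.
Qed.

(** The entropy [E e] at scale [e] is at most [h] for all [e > 0], and at least [h - d] once [e] is
    below a suitable [1 / (k + 1)]. *)
Lemma product_subshift_entropy (h : R) :
  (forall k, (growth_rate (log_words k) <= h%:E)%E) ->
  (forall e, 0 < e -> exists k, (h%:E <= growth_rate (log_words k) + e%:E)%E) ->
  topological_entropy f = h%:E.
Proof.
move=> le_h ge_h; apply/cvg_lim => //.
set E := (X in X e @[e --> _]).
have E_le e : 0 < e -> (E e <= h%:E)%E.
  move=> e0; apply: le_trans (le_h (Num.truncn e^-1)); apply: entropy_scale_le.
  by rewrite invf_ple ?posrE// ltW// truncnS_gt.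
have E_ge d : 0 < d -> \forall e \near 0^'+, (h%:E <= E e + d%:E)%E.
  move=> d0; have [k hk] := ge_h _ d0; near=> e.
  apply: (le_trans hk); rewrite leeD2r// entropy_scale_ge//.
  by near: e; apply: nbhs_right_le; rewrite invr_gt0.
(* Near 0, [E e] lies between [h - 1] and [h], so its convergence can be checked in [R]. *)
have E_fin : \forall e \near 0^'+, E e \is a fin_num.
  near=> e; have := E_le e.
  have : (h%:E <= E e + 1%:E)%E by near: e; exact: E_ge.
  by case: (E e) => [r| |] //= _ /(_ _)/negP; rewrite ?leye_eq => -[]//.
apply/fine_cvgP; split=> //; apply/cvgrPdist_le => d d0; near=> e.
have e0 : 0 < e by [].
have := E_le _ e0; have : (h%:E <= E e + d%:E)%E by near: e; exact: E_ge.
rewrite /comp -(@fineK _ (E e)); last by near: e.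
rewrite -EFinD !lee_fin/= => hE Eh.
by rewrite ger0_norm ?subr_ge0// lerBlDr addrC.
Unshelve. all: by end_near. Qed.

End product_entropy.

(** * Counting words with spaced ones *)

Definition spaced L (x : nat -> bool) : Prop :=
  forall s t, (s < t)%N -> x s -> x t -> (s + L <= t)%N.

Lemma card_words_le Q n : (#|words Q n| <= 2 ^ n)%N.
Proof. by rewrite (leq_trans (max_card _))// card_ffun card_bool card_ord. Qed.

Lemma card_words_spaced_le L n : (0 < L)%N ->
  (#|words (spaced L) n| <= L.+1 ^ (n %/ L).+1)%N.
Proof.
move=> L0.
(* A block of length [L] contains at most one [1], recorded by its position. *)
pose decode (p : {ffun 'I_(n %/ L).+1 -> option 'I_L}) : {ffun 'I_n -> bool} :=
  [ffun t : 'I_n => omap val (p (inord (t %/ L))) == Some (t %% L)%N].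
have -> : (L.+1 ^ (n %/ L).+1)%N =
    #|[set: {ffun 'I_(n %/ L).+1 -> option 'I_L}]%SET|.
  by rewrite cardsT card_ffun card_option !card_ord.
apply: leq_trans (leq_imset_card decode _).
apply/subset_leq_card/fintype.subsetP => w; rewrite inE => /asboolP[x Lx wx].
apply/imsetP; exists [ffun j : 'I__ => [pick r : 'I_L | x (j * L + r)%N]] => //.
apply/ffunP => t; rewrite !ffunE wx.
have tL : (t %/ L < (n %/ L).+1)%N by rewrite ltnS leq_div2r// ltnW.
rewrite inordK//; case: pickP => [r xr|xN] /=; last first.
  by have := xN (Ordinal (ltn_pmod t L0)); rewrite /= -divn_eq.
apply/idP/eqP => [xt|[rt]]; last by move: xr; rewrite rt -divn_eq.
(* Two ones at different positions [r] and [m] of the same block would be less than [L] apart. *)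
congr Some; have tE := divn_eq t L; have tL' := ltn_pmod t L0.
have rL := ltn_ord r; move: (t %/ L * L)%N (t %% L)%N tE tL' xr => b m tE mL xr.
have [rm|mr|//] := ltngtP r m.
- have : (b + r < t)%N by rewrite tE ltn_add2l.
  by move=> /(Lx _ _)/(_ xr xt); lia.
- have : (t < b + r)%N by rewrite tE ltn_add2l.
  by move=> /(Lx _ _)/(_ xt xr); lia.
Qed.

(** Letters at the multiples of [L] can be chosen freely, all others being zero; [n %/ L] of these
    multiples certainly fall below [n]. *)
Lemma card_words_spaced_ge L n : (0 < L)%N ->
  (2 ^ (n %/ L) <= #|words (spaced L) n|)%N.
Proof.
move=> L0.
pose x (p : {ffun 'I_(n %/ L) -> bool}) t :=
  (L %| t)%N && [exists j : 'I_(n %/ L), (t == j * L)%N && p j].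
pose code p : {ffun 'I_n -> bool} := [ffun t : 'I_n => x p t].
have xE p (j : 'I_(n %/ L)) : x p (j * L)%N = p j.
  rewrite /x dvdn_mull//=; apply/existsP/idP => [[k /andP[]]|pj].
    by rewrite eqn_pmul2r// => /eqP/val_inj ->.
  by exists j; rewrite eqxx.
have code_inj : injective code.
  move=> p q /ffunP pq; apply/ffunP => j; rewrite -!xE.
  have jn : (j * L < n)%N by rewrite (leq_trans _ (leq_divM n L))// ltn_pmul2r.
  by have := pq (Ordinal jn); rewrite !ffunE.
rewrite -card_bool -[X in (_ ^ X)%N](card_ord (n %/ L)) -card_ffun -cardsT.
rewrite -(card_imset _ code_inj).
apply/subset_leq_card/fintype.subsetP => _ /imsetP[p _ ->].
rewrite inE; apply/asboolP; exists (x p) => [s t st|t]; last by rewrite ffunE.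
move=> /andP[/dvdnP[i si] _] /andP[/dvdnP[j tj] _]; move: st; rewrite si tj.
by rewrite ltn_pmul2r// -mulSnr leq_pmul2r.
Qed.

Section spaced_growth.
Variable R : realType.

Lemma ln_words_spaced_le L n : ln #|words (spaced L.+1) n|%:R <=
  ln L.+2%:R / L.+1%:R * n%:R + ln L.+2%:R :> R.
Proof.
have L0 : (0 : R) < L.+1%:R by rewrite ltr0n.
have lnL : 0 <= ln (L.+2%:R : R) by rewrite ln_ge0// ler1n.
apply: (@le_trans _ _ (ln (L.+2%:R ^+ (n %/ L.+1).+1))).
  rewrite ler_ln ?posrE ?exprn_gt0//.
    by rewrite -natrX ler_nat card_words_spaced_le.
  by rewrite ltr0n (leq_trans _ (card_words_spaced_ge _ _))// expn_gt0.
rewrite lnXn// mulrSr lerD2r mulrAC ler_pdivlMr// -[X in X * _]mulr_natr -mulrA.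
rewrite ler_wpM2l// -natrM ler_nat leq_divM//.
Qed.

Lemma ln_words_spaced_ge L n :
  ln 2 / L.+1%:R * n%:R - ln 2 <= ln #|words (spaced L.+1) n|%:R :> R.
Proof.
have L0 : (0 : R) < L.+1%:R by rewrite ltr0n.
have ln2 : 0 <= ln (2 : R) by rewrite ln_ge0// ler1n.
apply: (@le_trans _ _ (ln (2 ^+ (n %/ L.+1)))); last first.
  rewrite ler_ln ?posrE ?exprn_gt0//.
    by rewrite -natrX ler_nat card_words_spaced_ge.
  by rewrite ltr0n (leq_trans _ (card_words_spaced_ge _ _))// expn_gt0.
rewrite lnXn// lerBlDr -mulrSr mulrAC ler_pdivrMr// -[X in _ <= X * _]mulr_natr.
by rewrite -mulrA ler_wpM2l// -natrM ler_nat ltnW// -ltn_divLR.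
Qed.

(** With [s = r * (L + 1)], the choice of [L] gives [s ^ 2 / 2 > L + 1], whence
    [expR s >= 1 + s ^ 2 / 2 > L + 2]. *)
Lemma ln_div_small (r : R) : 0 < r -> exists L, ln L.+2%:R / L.+1%:R < r.
Proof.
move=> r0; pose L := Num.truncn (2 / r ^+ 2).
have Lr : 2 < L.+1%:R * r ^+ 2 by rewrite -ltr_pdivrMr ?exprn_gt0// truncnS_gt.
have L0 : (0 : R) < L.+1%:R by rewrite ltr0n.
exists L; rewrite ltr_pdivrMr// -[ltRHS]expRK ltr_ln ?posrE ?expR_gt0//.
apply: (@lt_le_trans _ _ (1 + (r * L.+1%:R) ^+ 2 / 2)); last first.
  by apply: (@expR_ge1Dxn _ _ 1); rewrite mulr_ge0// ltW.
rewrite -[L.+2%:R]natr1 addrC ltrD2l ltr_pdivlMr// exprMn [_ ^+ 2 * _]mulrC.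
by rewrite [X in _ < X * _]expr2 -mulrA ltr_pM2l.
Qed.

End spaced_growth.

(** * Greedy choice of the spacings *)

(** Here [v L] is the logarithmic word count of a row with parameter [L], growing at a rate between
    [a L] and [c L]; [u] is the count of the initial row. *)
Lemma greedy_growth (R : realType) (u : nat -> R) (v : nat -> nat -> R)
    (a c D : nat -> R) (h : R) :
  (forall L, 0 < a L) -> {homo a : L L' / (L <= L')%N >-> L' <= L} ->
  (forall r, 0 < r -> exists L, c L < r) ->
  (forall L n, a L * n%:R - D L <= v L n <= c L * n%:R + D L) ->
  growth_rate u \is a fin_num -> (growth_rate u < h%:E)%E ->
  exists Ls : nat -> nat,
    let w k n := u n + \sum_(i < k) v (Ls i) n in
    (forall k, (growth_rate (w k) <= h%:E)%E) /\
    (forall e, 0 < e -> exists k, (h%:E <= growth_rate (w k) + e%:E)%E).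
Proof.
move=> a_gt0 a_homo c_small v_bound u_fin u_lt.
(* [pick r] is the least [L] with [c L < r]; the default 0 does not occur for [r > 0]. *)
pose pick r := if pselect (exists L, c L < r) is left e then ex_minn e else 0%N.
pose next u : nat -> R := fun n => u n + v (pick (h - fine (growth_rate u))) n.
pose w k := iter k next u; pose G k := fine (growth_rate (w k)).
pose Ls k := pick (h - G k).
have pickP r : 0 < r -> c (pick r) < r.
  by move=> /c_small cr; rewrite /pick; case: pselect => // e; case: ex_minnP.
have pick_min r L : c L < r -> (pick r <= L)%N.
  move=> cr; rewrite /pick; case: pselect => [e|]; last by case; exists L.
  by case: ex_minnP => m _; exact.
have w_le k : (growth_rate (w k.+1) <= growth_rate (w k) + (c (Ls k))%:E)%E.
  apply: (@le_growth_rate _ _ _ _ (D (Ls k))) => n.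
  by rewrite -addrA lerD2l; have /andP[] := v_bound (Ls k) n.
have w_ge k : (growth_rate (w k) + (a (Ls k))%:E <= growth_rate (w k.+1))%E.
  rewrite -leeBrDr// -EFinN.
  apply: (@le_growth_rate _ _ _ _ (D (Ls k))) => n.
  rewrite -!addrA lerDl mulNr; have /andP[+ _] := v_bound (Ls k) n.
  rewrite -/(Ls k); lra.
(* Finiteness and the bound [G k < h] are proved together: the room [h - G k] must be positive for
   the next [pick] to stay within it. *)
have GP k : growth_rate (w k) = (G k)%:E /\ G k < h.
  elim: k => [|k [GE Gh]]; first by rewrite fineK// -lte_fin fineK.
  have := w_le k; have := w_ge k; rewrite /G GE -!EFinD.
  case: (growth_rate (w k.+1)) => [g| |]//=; rewrite !lee_fin => _ gc.
  split=> //; apply: (le_lt_trans gc); rewrite -ltrBrDl; apply: pickP.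
  by rewrite subr_gt0.
have G_ge k : G k + a (Ls k) <= G k.+1.
  by have := w_ge k; rewrite !(GP _).1 -EFinD lee_fin.
exists Ls => w'.
have -> : w' = w.
  apply/funext; elim=> [|k IHk]; apply/funext => n.
    by rewrite /w' big_ord0 addr0.
  by rewrite /w' big_ord_recr/= addrA -/(w' k n) IHk.
split=> [k|e e0]; first by rewrite (GP k).1 lee_fin ltW// (GP k).2.
apply: contrapT => noexist.
have G_lt k : G k + e < h.
  rewrite ltNge; apply/negP => hG; apply: noexist.
  by exists k; rewrite (GP k).1 -EFinD lee_fin.
have [L cL] := c_small _ e0.
(* If at least [e] of room always remained, a fixed [L] with [c L < e] would be admissible at each
   step. Each step would then gain at least [a L], and [G] would exceed [h]. *)
have Ls_le k : (Ls k <= L)%N.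
  by apply: pick_min; apply: (lt_trans cL); have := G_lt k; lra.
have G_ge0 k : G 0%N + a L * k%:R <= G k.
  elim: k => [|k IHk]; first by rewrite mulr0 addr0.
  have := a_homo _ _ (Ls_le k); have := G_ge k.
  rewrite -natr1 mulrDr mulr1; lra.
pose k := (Num.truncn ((h - G 0%N) / a L)).+1.
have : (h - G 0%N) / a L < k%:R by exact: truncnS_gt.
rewrite ltr_pdivrMr// mulrC; have := G_ge0 k; have := (GP k).2; lra.
Qed.

(** * Gluing and gap functions *)

(** The zero at [u] ends the run, and [t] is any later one. A run without end is allowed, so the row
    of ones satisfies the condition. *)
Definition run_gap (R : realType) (tau : R) (x : nat -> bool) : Prop :=
  forall s u t, (s < u)%N -> (u < t)%N -> (forall v, (s <= v < u)%N -> x v) ->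
    ~~ x u -> x t -> tau * (u - s)%:R <= (t - u)%:R.

Section glue.
Variables (k : nat) (lo hi : nat -> nat) (x : nat -> nat -> bool).

Definition glue (s : nat) : bool :=
  [exists j : 'I_k, (lo j <= s < hi j)%N && x j (s - lo j)%N].

Lemma glueP s : reflect
  (exists j, [/\ (j < k)%N, (lo j <= s < hi j)%N & x j (s - lo j)%N]) (glue s).
Proof.
apply: (iffP existsP) => [[j /andP[js xjs]]|[j [jk js xjs]]].
  by exists j; split.
by exists (Ordinal jk); rewrite js.
Qed.

Hypothesis hi_le_lo : forall i j, (i < j)%N -> (j < k)%N -> (hi i <= lo j)%N.

Lemma glueE j s : (j < k)%N -> (lo j <= s < hi j)%N ->
  glue s = x j (s - lo j)%N.
Proof.
move=> jk js; apply/glueP/idP => [[i [ik is_ xis]]|xjs]; last by exists j.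
have [ij|ji|<-//] := ltngtP i j.
- by have := hi_le_lo ij jk; lia.
- by have := hi_le_lo ji ik; lia.
Qed.

Lemma spaced_glue L : (forall j, spaced L (x j)) ->
  (forall i j, (i < j)%N -> (j < k)%N -> (hi i + L <= lo j)%N) -> spaced L glue.
Proof.
move=> xL hiL s t st /glueP[i [ik si xis]] /glueP[j [jk tj xjt]].
have [ij|ji|ij] := ltngtP i j.
- by have := hiL _ _ ij jk; lia.
- by have := hi_le_lo ji ik; lia.
- move: si xis; rewrite ij => sj xjs.
  have st' : (s - lo j < t - lo j)%N by lia.
  by have := xL j _ _ st' xjs xjt; lia.
Qed.

(** A run of ones stays inside one block, since blocks are separated by at least one zero. If the
    later one is in the same block, the condition is inherited; otherwise the gap is long enough for
    a run filling the whole block. *)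
Lemma run_gap_glue (R : realType) (tau : R) : 0 < tau ->
  (forall j, run_gap tau (x j)) ->
  (forall i j, (i < j)%N -> (j < k)%N ->
     (hi i < lo j)%N /\ tau * (hi i - lo i)%:R <= (lo j - hi i)%:R) ->
  run_gap tau glue.
Proof.
move=> tau0 xtau hi_lo s u t su ut ones zu zt.
have /glueP[i [ik iu xiu]] : glue u.-1 by apply: ones; lia.
(* The position just before block [i] belongs to no block, as [hi j < lo i] is strict. *)
have lo_s : (lo i <= s)%N.
  rewrite leqNgt; apply/negP => s_lo.
  have /glueP[j [jk js xjs]] : glue (lo i).-1 by apply: ones; lia.
  have [ij|ji|ij] := ltngtP i j; first by have := hi_le_lo ij jk; lia.
    by have [+ _] := hi_lo _ _ ji ik; lia.
  by subst j; lia.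
have /glueP[j [jk tj xjt]] := zt.
have [ij|ji|ij] := ltngtP i j; last 1 first.
- subst j; have := xtau i (s - lo i)%N (u - lo i)%N (t - lo i)%N.
  rewrite (_ : u - lo i - (s - lo i) = u - s)%N; last by lia.
  rewrite (_ : t - lo i - (u - lo i) = t - u)%N; last by lia.
  apply=> //; [by lia|by lia| |].
  + move=> v sv; rewrite -[v](addnK (lo i)) -glueE//; last by lia.
    by apply: ones; lia.
  + by rewrite -glueE//; lia.
- have [hl tl] := hi_lo _ _ ij jk.
  apply: (@le_trans _ _ (tau * (hi i - lo i)%:R)).
    by rewrite ler_pM2l// ler_nat; lia.
  by apply: (le_trans tl); rewrite ler_nat; lia.
- by have := hi_le_lo ji ik; lia.
Qed.

End glue.

(** * The layered shift and its gap function *)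

Section layered_shift.
Variables (R : realType) (tau : R) (Ls : nat -> nat).

Definition layer i : (nat -> bool) -> Prop :=
  if i is j.+1 then spaced (Ls j).+1 else run_gap tau.

Definition layered (x : nat -> nat -> bool) : Prop := forall i, layer i (x i).

Lemma layer_false i : layer i (fun=> false).
Proof. by case: i => [|i] //= s u t. Qed.

Lemma layered_shift x : layered x -> layered (time_shift x).
Proof.
move=> Px [|i] /=.
  move=> s u t su ut ones xu xt.
  have := Px 0%N s.+1 u.+1 t.+1 su ut _ xu xt.
  by rewrite !subSS; apply => -[//|v]; exact: ones.
move=> s t st xs xt.
by have := Px i.+1 s.+1 t.+1 st xs xt.
Qed.

Lemma layered_closed x :
  (forall k, exists2 y, layered y & agree k x y) -> layered x.
Proof.
move=> xP [|i].
  move=> s u t su ut ones xu xt; have [y Py /agreeP xy] := xP t.+1.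
  apply: (Py 0%N) => //=; rewrite -?xy//; last by lia.
  by move=> v sv; rewrite -xy ?ones//; lia.
move=> s t st xs xt; have [y Py /agreeP xy] := xP (maxn t i.+1).+1.
by apply: (Py i.+1) => //=; rewrite -?xy//; lia.
Qed.

Local Notation X := (seq_space R layered).
Local Notation f := (@shift_map R _ layered_shift).

(** Scale [e] sees [m] rows and [m] columns, so a segment of length [n] is copied with up to [n + m]
    letters. The two truncations cover [tau * (n + m)], the term [m] the extra letters, and the sum
    each spacing in the visible rows. Only the first term depends on [n]. *)
Definition gap n (e : R) : nat :=
  let m := Num.truncn e^-1 in
  ((Num.truncn (tau * n%:R)).+1 +
   ((Num.truncn (tau * m%:R)).+1 + m + \sum_(i < m) (Ls i).+1))%N.

Hypothesis tau_gt0 : 0 < tau.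

Lemma gap_function_gap : gap_function f gap.
Proof.
split=> [n e _ _|m n e _ mn _|n d e _ d0 de|e k x a b e0 _ ab ba gap_ab].
- by rewrite /gap addSn.
- by rewrite /gap leq_add2r ltnS le_truncn// ler_pM2l// ler_nat.
- have de' : (Num.truncn e^-1 <= Num.truncn d^-1)%N.
    by rewrite le_truncn// lef_pV2// posrE (lt_le_trans d0).
  rewrite /gap leq_add2l leq_add//.
    by rewrite leq_add// ltnS le_truncn// ler_pM2l// ler_nat.
  by rewrite -!(big_mkord xpredT (fun i => (Ls i).+1)) 
    [leqRHS](big_cat_nat _ de')//= leq_addr.
pose m := Num.truncn e^-1; pose hi j := (b j + m)%N.
(* The gap after segment [i] is needed before every later segment, not only the next one. *)
have gap_le i j : (i < j)%N -> (j < k)%N ->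
    (b i + gap (b i - a i + 1) e <= a j)%N.
  elim: j => // j IHj; rewrite ltnS leq_eqVlt => /predU1P[->|ij] jk.
    by have := gap_ab j jk; have := ba j jk; lia.
  have := IHj ij (ltnW jk); have := ab j (ltnW jk); have := ba j jk; lia.
have gapE n : gap n e = ((Num.truncn (tau * n%:R)).+1 +
   ((Num.truncn (tau * m%:R)).+1 + m + \sum_(i < m) (Ls i).+1))%N by [].
have hi_lt i j : (i < j)%N -> (j < k)%N -> (hi i < a j)%N.
  by move=> ij jk; have := gap_le _ _ ij jk; rewrite gapE /hi; lia.
have hi_le i j : (i < j)%N -> (j < k)%N -> (hi i <= a j)%N.
  by move=> ij jk; rewrite ltnW ?hi_lt.
(* Rows from [m] on are invisible at scale [e] and are set to zero. *)
pose z i s := (i < m)%N && glue k a hi (fun j => x j i) s.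
have Pz : layered z.
  move=> i; rewrite /z; have [im|_] := ltnP i m; last exact: layer_false.
  case: i im => [|i] im /=.
    apply: run_gap_glue => // [j|i j ij jk]; first exact: (coordsP (x j) 0%N).
    split; first exact: hi_lt.
    have ik := ltn_trans ij jk; have := gap_le _ _ ij jk; rewrite gapE => ga.
    have t1 := ltW (truncnS_gt (tau * (b i - a i + 1)%:R)).
    have t2 := ltW (truncnS_gt (tau * m%:R)).
    apply: (@le_trans _ _ (tau * (b i - a i + 1)%:R + tau * m%:R)).
      by rewrite -mulrDr ler_pM2l// -natrD ler_nat /hi; have := ab i ik; lia.
    apply: (le_trans (lerD t1 t2)); rewrite -natrD ler_nat /hi.
    move: (Num.truncn _) (Num.truncn _) (\sum_(_ < m) _)%N ga => p q r; lia.
  apply: spaced_glue => // [j|i' j ij jk]; first exact: (coordsP (x j) i.+1).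
  have := gap_le _ _ ij jk; rewrite gapE /hi.
  have : ((Ls i).+1 <= \sum_(i < m) (Ls i).+1)%N.
    by rewrite (bigD1 (Ordinal (ltnW im)))//= leq_addr.
  lia.
exists (SeqSpace R Pz) => j n jk ajn.
apply: (@le_trans _ _ m.+1%:R^-1); last first.
  by rewrite invf_ple ?posrE// ltW// truncnS_gt.
rewrite mdist_le_agree; apply/agreeP => i t im tm.
rewrite !iter_shiftE/= /z im/= (@glueE _ _ _ _ _ j)//.
  by rewrite addnBAC//; lia.
by rewrite /hi; lia.
Qed.

Lemma gap_cvg e : (gap n e)%:R / n%:R @[n --> \oo] --> tau.
Proof.
pose m := Num.truncn e^-1.
pose D := ((Num.truncn (tau * m%:R)).+1 + m + \sum_(i < m) (Ls i).+1)%N.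
apply/cvgrPdist_le => d d0; near=> n.
have n0 : 0 < n%:R :> R by rewrite ltr0n; near: n; exact: nbhs_infty_gt.
have Dn : D.+1%:R / d < n%:R by near: n; exact: nbhs_infty_gtr.
have gapE : (gap n e)%:R = (Num.truncn (tau * n%:R))%:R + D.+1%:R :> R.
  by rewrite -natrD addnS -addSn.
have le_gap : tau * n%:R <= (gap n e)%:R.
  by apply: (le_trans (ltW (truncnS_gt _))); rewrite ler_nat leq_addr.
have gap_le : (gap n e)%:R <= tau * n%:R + D.+1%:R.
  by rewrite gapE lerD2r truncn_le// mulr_ge0// ltW.
(* The error lies between 0 and [(D + 1) / n]. *)
rewrite distrC ger0_norm ?subr_ge0 ?ler_pdivlMr//.
rewrite lerBlDr ler_pdivrMr// mulrDl addrC (le_trans gap_le)// lerD2l.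
by rewrite mulrC -ler_pdivrMr// ltW.
Unshelve. all: by end_near. Qed.

(** Scale 1/2 sees exactly the entry at row 0, time 0. The word [1^n] is followed, after the gap
    [g], by [01]: the 0 forces the initial run to end, and the 1 bounds the number of zeros after
    it. *)
Lemma gap_function_ge M n : gap_function f M -> (0 < n)%N ->
  tau * n%:R <= (M n 2^-1)%:R.
Proof.
move=> [M_gt0 _ _ spec] n0; set g := M n 2^-1.
have P0 : layered (fun i _ => i == 0%N) by case=> [|i] //= s u t.
have P1 : layered (fun i t => (i == 0%N) && (t == 1%N)).
  case=> [|i] //= s u t su ut ones _ /eqP t1.
  have /eqP s1 : s == 1%N by apply: ones; lia.
  by move: su ut; rewrite s1 t1; lia.
pose x j := if j is 0 then SeqSpace R P0 else SeqSpace R P1.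
pose a j := (if j is 0 then 0 else n.-1 + g)%N.
pose b j := (if j is 0 then n.-1 else n + g)%N.
have g0 : (0 < g)%N by exact: M_gt0.
have [|//||||z zP] := spec 2^-1 2%N x a b.
- by rewrite invr_gt0.
- by case=> [|j] //= j2; lia.
- by case=> [|j] //= j2; lia.
- by case=> [|j] //= _; rewrite subn0 addn1 prednK// -/g; lia.
have zE j t : (j < 2)%N -> (a j <= t <= b j)%N -> z 0%N t = x j 0%N (t - a j)%N.
  move=> j2 jt; have := zP j t j2 jt; rewrite mdist_le_agree.
  move=> /agreeP/(_ 0%N 0%N isT isT).
  by rewrite !iter_shiftE !addn0 => ->.
have z1 t : (t < n)%N -> z 0%N t by move=> tn; rewrite (zE 0%N)//=; lia.
have z0 : ~~ z 0%N (n.-1 + g)%N by rewrite (zE 1%N)//= ?subnn//; lia.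
have zng : z 0%N (n + g)%N.
  by rewrite (zE 1%N)//=; [apply/eqP; lia|lia].
(* The first zero [u] satisfies [n <= u < n + g], so that [tau * n <= tau * u <= n + g - u <= g]. *)
have ex_zero : exists u, ~~ z 0%N u by exists (n.-1 + g)%N.
case: (ex_minnP ex_zero) => u zu u_min.
have nu : (n <= u)%N by rewrite leqNgt; apply: contra zu; exact: z1.
have ug : (u < n + g)%N by have := u_min _ z0; lia.
have ones v : (0 <= v < u)%N -> z 0%N v.
  by move=> vu; apply: contraT => /u_min; lia.
have := coordsP z 0%N 0%N u (n + g)%N (leq_trans n0 nu) ug ones zu zng.
rewrite subn0 => run; apply: (le_trans _ (le_trans run _)).
  by rewrite ler_pM2l// ler_nat.
by rewrite ler_nat; lia.
Qed.

End layered_shift.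

(** * Specification rate, dynamics and entropy of the layered shift *)

Lemma growth_rate0 (R : realType) : growth_rate (fun=> 0 : R) = 0%E.
Proof.
rewrite /growth_rate; under eq_fun do rewrite mul0r.
by have [_ ->] := cvg_limn_einf_sup (cvg_cst (0%E : \bar R)).
Qed.

Lemma limn_einf_ge (R : realType) (u : nat -> \bar R) (l : R) :
  (forall n, (0 < n)%N -> (l%:E <= u n)%E) -> (l%:E <= limn_einf u)%E.
Proof.
move=> lu; rewrite /limn_einf leeNr.
have [_ <-] := cvg_limn_einf_sup (cvg_cst (- l%:E : \bar R)%E).
rewrite -[leRHS]adde0; apply: (@le_limn_esup _ _ _ _ 0) => n n0.
by rewrite add0r mul0r adde0 leeN2 lu.
Qed.

Lemma layered_specification (R : realType) (tau : R) (Ls : nat -> nat) :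
  0 < tau ->
  nonuniform_tau_specification
    (@shift_map R _ (@layered_shift R tau Ls)) tau%:E.
Proof.
move=> tau0; split=> [|M Mgap].
  exists (@gap R tau Ls); first exact: gap_function_gap.
  rewrite /gap_rate (_ : [set _ | e in _] = [set tau%:E]) ?ereal_sup1//.
  (* The rate is [tau] at every scale, so the supremum is over a single value. *)
  have rate e : limn_einf (fun n => ((gap tau Ls n e)%:R / n%:R)%:E) = tau%:E.
    suff /cvg_limn_einf_sup[-> //] :
        ((gap tau Ls n e)%:R / n%:R)%:E @[n --> \oo] --> tau%:E.
    by apply: cvg_EFin; [exact: nearW|exact: gap_cvg].
  apply/seteqP; split=> [_ [e _ <-]|_ ->]; first exact: rate.
  by exists 1 => //; exact: ltr01.
apply: (@le_trans _ _ (limn_einf (fun n => ((M n 2^-1)%:R / n%:R)%:E))).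
  apply: limn_einf_ge => n n0; rewrite lee_fin ler_pdivlMr ?ltr0n//.
  exact: (gap_function_ge tau0 Mgap).
by apply: ereal_sup_ubound; exists 2^-1; rewrite //= invr_gt0.
Qed.

Lemma layered_dynamics (R : realType) (tau : R) (Ls : nat -> nat) :
  topological_dynamical_system (@shift_map R _ (@layered_shift R tau Ls)).
Proof.
split; last exact: continuous_shift_map.
- exact: compact_seq_space (@layered_closed R tau Ls).
- have P1 : layered tau Ls (fun i _ => i == 0%N) by case=> [|i] //= s u t.
  exists (SeqSpace R P1), (SeqSpace R (@layer_false R tau Ls)).
  by move=> /(congr1 (@coords _ _)) /(congr1 (fun x => x 0%N 0%N)).
Qed.

Lemma exists_layered_entropy (R : realType) (tau h : R) : ln 2 < h ->
  exists Ls,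
    topological_entropy (@shift_map R _ (@layered_shift R tau Ls)) = h%:E.
Proof.
move=> h_gt; pose u n : R := ln #|words (run_gap tau) n|%:R.
have u_ge0 n : 0 <= u n.
  by rewrite ln_ge0// ler1n (card_words_gt0 _ (@layer_false R tau id 0)).
have growth_ge0 : (0 <= growth_rate u)%E.
  rewrite -growth_rate0 -[leRHS]adde0; apply: (@le_growth_rate _ _ _ 0 0) => n.
  by rewrite mul0r !addr0.
have growth_le : (growth_rate u <= (ln 2)%:E)%E.
  rewrite -[leRHS]add0e -growth_rate0; apply: (@le_growth_rate _ _ _ _ 0) => n.
  rewrite add0r addr0 mulr_natr -lnXn// ler_ln ?posrE ?exprn_gt0//.
    by rewrite -natrX ler_nat card_words_le.
  by rewrite ltr0n (card_words_gt0 _ (@layer_false R tau id 0)).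
have lnL L : 0 <= ln (L.+1%:R : R) by rewrite ln_ge0// ler1n.
have [||||||Ls [le_h ge_h]] := @greedy_growth R u
  (fun L n => ln #|words (spaced L.+1) n|%:R) (fun L => ln 2 / L.+1%:R)
  (fun L => ln L.+2%:R / L.+1%:R) (fun L => ln L.+2%:R) h.
- by move=> L; rewrite divr_gt0 ?ltr0n// ln_gt0// ltr1n.
- move=> L L' LL'; rewrite ler_wpM2l// lef_pV2 ?posrE ?ltr0n// ler_nat ltnS//.
- exact: ln_div_small.
(* The constant [ln (L + 2)] of the upper bound also dominates the constant [ln 2] of the lower
   bound. *)
- move=> L n; rewrite ln_words_spaced_le andbT.
  apply: le_trans (ln_words_spaced_ge R L n).
  by rewrite lerB// ler_ln ?posrE ?ltr0n// ler_nat.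
- by rewrite ge0_fin_numE// (le_lt_trans growth_le)// ltry.
- by rewrite (le_lt_trans growth_le)// lte_fin.
have wE k : log_words R (layer tau Ls) k.+1 =
    (fun n => u n + \sum_(i < k) ln #|words (spaced (Ls i).+1) n|%:R).
  by apply/funext => n; rewrite /log_words big_ord_recl.
exists Ls.
apply: (product_subshift_entropy (@layer_false R tau Ls)) => [[|k]|e e0].
(* The empty set of rows has growth 0, at most that of row 0 alone. *)
- rewrite (le_trans _ (le_h 0%N))// -wE -[leRHS]adde0.
  apply: (@le_growth_rate _ _ _ 0 0) => n.
  by rewrite /log_words big_ord0 mul0r !addr0 big_ord1; exact: u_ge0.
- by rewrite wE.
- by have [k hk] := ge_h _ e0; exists k.+1; rewrite wE.
Qed.

Theorem corollary2 (R : realType) (tau h : R) (tau_gt0 : 0 < tau)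
    (h_gt : ln (2 * (Num.ceil (2 `^ ((1 + tau) / tau)))%:~R
                      `^ (1 / (1 + tau))) < h) :
  exists (X : metricType R) (f : X -> X) (M : nat -> R -> nat),
    [/\ topological_dynamical_system f,
        nonuniform_tau_specification f tau%:E,
        gap_function f M,
        \forall e \near 0^'+, (M n e)%:R / n%:R @[n --> \oo] --> tau
      & topological_entropy f = h%:E].
Proof.
(* The ceiling is at least 1, and so is its power, so the assumed lower bound on [h] is at least
   [ln 2]. *)
have ln2_lt : ln 2 < h.
  set c := (Num.ceil _)%:~R : R in h_gt.
  have c1 : 1 <= c by rewrite ler1z -gtz0_ge1 ceil_gt0 powR_gt0.
  have pow1 : 1 <= c `^ (1 / (1 + tau)).
    by rewrite -[leLHS](powRr0 c) ler_powR// divr_ge0// addr_ge0// ltW.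
  apply: le_lt_trans h_gt; rewrite ler_ln ?posrE// ?ler_pMr//.
  by rewrite mulr_gt0// (lt_le_trans _ pow1).
have [Ls entropy] := exists_layered_entropy tau ln2_lt.
exists (seq_space R (layered tau Ls)).
exists (@shift_map R _ (@layered_shift R tau Ls)), (gap tau Ls).
split=> //.
- exact: layered_dynamics.
- exact: layered_specification.
- exact: gap_function_gap.
- by apply: nearW => e; exact: gap_cvg.
Qed.
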